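(* Let $n\ge2$, let $X_1,\ldots,X_n$ be any collection of real numbers, let $C_n>0$, and let $\Delta_n=\max_{i=1,\ldots,n}|X_i-\bar X|$. If $\Delta_n\ge\frac{2\log n}{C_n}$, then $$\hat\xi_n^2\ge\frac{\Delta_n^2}{2\log n}.$$
   Context: $\bar X=\frac1n\sum_{i=1}^nX_i$. Let $L_n(\lambda)=\frac{2}{\lambda^2}\log\bigl\{\frac1n\sum_{i=1}^n e^{\lambda(X_i-\bar X)}\bigr\}$ for $\lambda\neq 0$ and $L_n(0)=\frac1n\sum_{i=1}^n(X_i-\bar X)^2$. Define $\hat\xi_n^2=\sup_{|\lambda|\le C_n}L_n(\lambda)$. *)

(* Defs.v *)
From mathcomp Require Import all_boot all_order all_algebra.
From mathcomp Require Import all_classical all_reals all_analysis.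

Set Implicit Arguments.
Unset Strict Implicit.
Unset Printing Implicit Defensive.

Import Order.TTheory GRing.Theory Num.Theory.
Local Open Scope classical_set_scope.
Local Open Scope ring_scope.

Definition sample_mean (R : realType) (n : nat) (X : 'I_n -> R) : R :=
  n%:R^-1 * \sum_(i < n) X i.

Definition Ln (R : realType) (n : nat) (X : 'I_n -> R) (lambda : R) : R :=
  if lambda == 0 then
    n%:R^-1 * \sum_(i < n) (X i - sample_mean X) ^+ 2
  else
    2 / lambda ^+ 2 *
      ln (n%:R^-1 * \sum_(i < n) expR (lambda * (X i - sample_mean X))).

(* This is the already squared estimator. The supremum is the one of R; the set
   is nonempty for 0 <= C, and bounded because [Ln X] is continuous, so that the
   default value of [sup] does not come into play. *)
Definition xihat_sq (R : realType) (n : nat) (X : 'I_n -> R) (C : R) : R :=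
  sup [set Ln X lambda | lambda in [set lambda : R | `|lambda| <= C]].

(* The terms are nonnegative, so starting the maximum from 0 is harmless as soon
   as 0 < n. *)
Definition max_dev (R : realType) (n : nat) (X : 'I_n -> R) : R :=
  \big[Num.max/0]_(i < n) `|X i - sample_mean X|.

(* Main.v *)
(* With D the largest deviation and lambda = +- 2 log n / D, a single term of
   the empirical moment generating function is already e^(2 log n) = n^2, so
   its logarithm is at least log n, and L_n(lambda) >= D^2 / (2 log n).
   That this bounds the supremum below requires L_n to be bounded above:
   e^x <= x + e^(2 x^2) and the vanishing of the sum of the deviations give
   L_n <= 4 D^2. *)
Require Import Defs.
From mathcomp Require Import all_boot all_order all_algebra.
From mathcomp Require Import all_classical all_reals all_analysis.
From mathcomp Require Import ring lra.
Set Implicit Arguments.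
Unset Strict Implicit.
Unset Printing Implicit Defensive.

Import Order.TTheory GRing.Theory Num.Theory.
Local Open Scope ring_scope.

Lemma expR_le_addr_expR_sqr (R : realType) (x : R) :
  expR x <= x + expR (2 * x ^+ 2).
Proof.
have [xlt|xge] := leP x (1 / 2); last first.
  (* For [x >= 1 / 2] one has [x <= 2 * x ^+ 2], and the extra [x] is positive. *)
  have : expR x <= expR (2 * x ^+ 2) by rewrite ler_expR; nra.
  lra.
(* [1 - x <= e^-x] gives [e^x <= 1 / (1 - x)], and [1 / (1 - x) <= 1 + x + 2 x^2]
   since [x <= 1 / 2]. *)
have h : expR x <= 1 + x + 2 * x ^+ 2.
  have h1 := expR_ge1Dx (- x).
  have h2 : expR (- x) * expR x = 1 by rewrite -expRD addNr expR0.
  have h3 := expR_gt0 x.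
  have h4 : 1 <= (1 - x) * (1 + x + 2 * x ^+ 2).
    (* This product is exactly [(1 - x) * (1 + x + 2 * x ^+ 2) - 1]. *)
    have : 0 <= x ^+ 2 * (1 - 2 * x) by rewrite mulr_ge0 ?sqr_ge0 //; lra.
    lra.
  have h5 : (1 - x) * expR x <= 1 by rewrite -h2 ler_pM2r //; lra.
  have : (1 - x) * expR x <= (1 - x) * (1 + x + 2 * x ^+ 2) by lra.
  by rewrite ler_pM2l //; lra.
have := expR_ge1Dx (2 * x ^+ 2); lra.
Qed.

Lemma sum_sub_sample_mean (R : realType) (n : nat) (X : 'I_n -> R) :
  (0 < n)%N -> \sum_(i < n) (X i - sample_mean X) = 0.
Proof.
move=> n0; rewrite big_split /= sumrN sumr_const card_ord -mulr_natl.
by rewrite /sample_mean mulrA divff ?pnatr_eq0 -?lt0n // mul1r subrr.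
Qed.

Lemma le_max_dev (R : realType) (n : nat) (X : 'I_n -> R) (i : 'I_n) :
  `|X i - sample_mean X| <= max_dev X.
Proof. exact: (le_bigmax _ (fun j => `|X j - sample_mean X|)). Qed.

(** Positivity rules out that the maximum is merely its starting value [0]: if every deviation were
    strictly smaller, the maximum would be smaller than itself. *)
Lemma max_dev_attained (R : realType) (n : nat) (X : 'I_n -> R) :
  0 < max_dev X -> exists i, `|X i - sample_mean X| = max_dev X.
Proof.
move=> D0; apply: contrapT => /forallNP noti.
suff : max_dev X < max_dev X by rewrite ltxx.
apply: bigmax_lt => // i _; rewrite lt_neqAle le_max_dev andbT.
exact/eqP/noti.
Qed.

Lemma sqr_dev_le (R : realType) (n : nat) (X : 'I_n -> R) (i : 'I_n) :
  (X i - sample_mean X) ^+ 2 <= max_dev X ^+ 2.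
Proof.
rewrite -(real_normK (num_real (X i - sample_mean X))).
rewrite lerXn2r ?nnegrE ?le_max_dev //.
exact: le_trans (normr_ge0 _) (le_max_dev X i).
Qed.

Lemma average_le (R : realType) (n : nat) (F : 'I_n -> R) (M : R) :
  (0 < n)%N -> (forall i, F i <= M) -> n%:R^-1 * \sum_(i < n) F i <= M.
Proof.
move=> n0 FM; rewrite ler_pdivrMl ?ltr0n //.
by rewrite mulr_natl -[n in leRHS]card_ord -sumr_const; apply: ler_sum.
Qed.

Lemma average_expR_gt0 (R : realType) (n : nat) (F : 'I_n -> R) :
  (0 < n)%N -> 0 < n%:R^-1 * \sum_(i < n) expR (F i).
Proof.
case: n F => // n F _; rewrite mulr_gt0 ?invr_gt0 ?ltr0n // big_ord_recl.
by rewrite ltr_pwDl ?expR_gt0 // sumr_ge0 // => i _; rewrite expR_ge0.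
Qed.

Lemma Ln_le (R : realType) (n : nat) (X : 'I_n -> R) (lambda : R) :
  (0 < n)%N -> Ln X lambda <= 4 * max_dev X ^+ 2.
Proof.
move=> n0; rewrite /Ln; case: eqVneq => [_|l0].
  apply: (@le_trans _ _ (max_dev X ^+ 2)); first exact/average_le/sqr_dev_le.
  have := sqr_ge0 (max_dev X); lra.
have l2 : 0 < lambda ^+ 2 by rewrite exprn_even_gt0.
rewrite mulrAC ler_pdivrMr //.
suff : ln (n%:R^-1 * \sum_(i < n) expR (lambda * (X i - sample_mean X)))
       <= 2 * (lambda ^+ 2 * max_dev X ^+ 2) by lra.
rewrite -[leRHS]expRK ler_ln ?posrE ?expR_gt0 ?average_expR_gt0 //.
(* The subtracted linear terms sum to zero. Each remaining summand is then at most [expR (2 *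
   (lambda ^+ 2 * max_dev X ^+ 2))], hence so is the average. *)
have -> : \sum_(i < n) expR (lambda * (X i - sample_mean X)) =
    \sum_(i < n) (expR (lambda * (X i - sample_mean X)) -
                  lambda * (X i - sample_mean X)).
  by rewrite big_split /= sumrN -mulr_sumr sum_sub_sample_mean // mulr0 subr0.
apply: average_le => // i; rewrite lerBlDl.
apply: le_trans (expR_le_addr_expR_sqr _) _.
by rewrite lerD2l ler_expR exprMn !ler_pM2l ?sqr_dev_le.
Qed.

Lemma has_ubound_Ln (R : realType) (n : nat) (X : 'I_n -> R) (C : R) :
  (0 < n)%N -> has_ubound [set Ln X l | l in [set l : R | `|l| <= C]]%classic.
Proof. by move=> n0; exists (4 * max_dev X ^+ 2) => _ [l _ <-]; exact: Ln_le. Qed.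

Lemma Ln_ge (R : realType) (n : nat) (X : 'I_n -> R) (lambda : R) (i : 'I_n) :
  lambda != 0 -> lambda * (X i - sample_mean X) = 2 * ln (n%:R : R) ->
  2 / lambda ^+ 2 * ln (n%:R : R) <= Ln X lambda.
Proof.
move=> l0 li; rewrite /Ln (negPf l0).
have n0 : (0 < n)%N by case: i {li} => i /=; exact: leq_trans.
have nR0 : (0 : R) < n%:R by rewrite ltr0n.
rewrite ler_pM2l ?divr_gt0 ?exprn_even_gt0 //.
rewrite ler_ln ?posrE ?average_expR_gt0 // ler_pdivlMl //.
(* The [i]-th term equals n^2: one factor n pays for the average, the other survives in the
   logarithm. *)
rewrite (bigD1 i) //= li expRM_natl lnK ?posrE // expr2 lerDl.
by apply: sumr_ge0 => j _; exact: expR_ge0.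
Qed.

Theorem proposition12 (R : realType) (n : nat) (X : 'I_n -> R) (C : R)
    (hn : (2 <= n)%N) (hC : 0 < C)
    (hDelta : max_dev X >= 2 * ln (n%:R : R) / C) :
  xihat_sq X C >= max_dev X ^+ 2 / (2 * ln (n%:R : R)).
Proof.
have n0 : (0 < n)%N by exact: ltnW.
have ln0 : 0 < ln (n%:R : R) by rewrite ln_gt0 // ltr1n.
have D0 : 0 < max_dev X by apply: lt_le_trans hDelta; rewrite divr_gt0 ?mulr_gt0.
have [i Di] := max_dev_attained D0.
have Y0 : X i - sample_mean X != 0 by rewrite -normr_gt0 Di.
(* Dividing by the signed deviation treats both signs of the extremal deviation at once. *)
pose lambda := 2 * ln (n%:R : R) / (X i - sample_mean X).
have l0 : lambda != 0 by rewrite mulf_neq0 ?invr_eq0 // gt_eqF ?mulr_gt0.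
(* Here [hDelta] enters, with [C] and [max_dev X] exchanged across the inequality. *)
have lC : `|lambda| <= C.
  rewrite normrM normfV Di gtr0_norm ?mulr_gt0 //.
  by rewrite ler_pdivrMr // [C * _]mulrC -ler_pdivrMr.
have lY : lambda * (X i - sample_mean X) = 2 * ln (n%:R : R) by rewrite divfK.
apply: (@le_trans _ _ (Ln X lambda)); last first.
  by apply: (ub_le_sup (has_ubound_Ln X C n0)); exists lambda.
apply: le_trans (Ln_ge l0 lY).
(* For this [lambda] the two sides coincide. *)
rewrite -Di real_normK ?num_real // /lambda le_eqVlt; apply/orP; left; apply/eqP.
by field; rewrite Y0 (gt_eqF ln0).
Qed.
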